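(* Let $T=\mathrm{co}(V)\subset\mathbb{R}^3$ be a (non-degenerate) tetrahedron with vertex set $V=\{v_1,v_2,v_3,v_4\}$. A four-crossing radius $R^L$ and four-crossing point $O^L$ of $T$ with $O^L\in\mathrm{int}(T)$ are uniquely determined by $T$: if $(R,O)$ and $(R',O')$ are two pairs, each consisting of a four-crossing radius and a corresponding four-crossing point of $T$, and $O,O'\in\mathrm{int}(T)$, then $R=R'$ and $O=O'$.
   Context: A pair $(R^L,O^L)$, with $R^L>0$ and $O^L\in\mathbb{R}^3$, is a four-crossing radius and four-crossing point of the tetrahedron $T$ if there exist four distinct spheres $S_1,S_2,S_3,S_4$ of radius $R^L$ such that: (a) for each $j$, $S_j$ contains the vertices $v_i$ for all $i\ne j$; (b) $S_1\cap S_2\cap S_3\cap S_4=\{O^L\}$; (c) $O^L$ does not belong to the circumsphere of $T$ (the unique sphere containing $V$). *)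

(* Defs.v *)
From HB Require Import structures.
From mathcomp Require Import all_boot all_order all_algebra.
From mathcomp Require Import all_classical all_reals all_analysis.

Set Implicit Arguments.
Unset Strict Implicit.
Unset Printing Implicit Defensive.

Import Order.TTheory GRing.Theory Num.Theory.
Import numFieldNormedType.Exports.

Local Open Scope classical_set_scope.
Local Open Scope ring_scope.

Section FourCrossing.
Variable R : realType.

(* The library norm on ['rV[R]_3] is the sup norm, so it cannot be used for
   spheres; the topology is the usual one. *)
Definition edist (x y : 'rV[R]_3) : R :=
  Num.sqrt (\sum_(k < 3) (x 0 k - y 0 k) ^+ 2).

Definition sphere (c : 'rV[R]_3) (r : R) : set 'rV[R]_3 :=
  [set x | edist x c = r].

Definition convex_hull (A : set 'rV[R]_3) : set 'rV[R]_3 :=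
  smallest (@convex_set R 'rV[R]_3) A.

Definition affinely_independent (v : 'I_4 -> 'rV[R]_3) : Prop :=
  forall a : 'I_4 -> R,
    \sum_(i < 4) a i = 0 -> \sum_(i < 4) a i *: v i = 0 -> forall i, a i = 0.

Definition tetrahedron (v : 'I_4 -> 'rV[R]_3) : set 'rV[R]_3 :=
  convex_hull (range v).

(* Unique when [v] is affinely independent. *)
Definition is_circumsphere (v : 'I_4 -> 'rV[R]_3) (S : set 'rV[R]_3) : Prop :=
  (exists c r, 0 < r /\ S = sphere c r) /\ range v `<=` S.

Definition four_crossing (v : 'I_4 -> 'rV[R]_3) (r : R) (O : 'rV[R]_3) : Prop :=
  0 < r /\
  exists S : 'I_4 -> set 'rV[R]_3,
    [/\ injective S,
        forall j, exists c, S j = sphere c r,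
        forall j i, i != j -> S j (v i),
        \bigcap_j S j = [set O] &
        forall C, is_circumsphere v C -> ~ C O].

End FourCrossing.

(* Main.v *)
(* Write [u_i = v_i - O], and let [c_j] be the center of the sphere through [O]
   and the face opposite to [v_j], [d_j = c_j - O]. Since [O] is interior,
   [\sum_i lam_i u_i = 0] with [lam_i > 0], and the sphere equations
   [|u_i|^2 = 2 u_i . d_j] give [\sum_j mu_j d_j = 0] for the positive weights
   [mu_j] proportional to [lam_j |u_j|^2]. In particular the four balls meet
   only at [O].

   The key fact is that [c_j] lies on the plane of the face opposite to [v_j],
   or on the side of it that does not contain [v_j]. With
   [x_i = mu_i (d_i - d_j)] for [i <> j], [X = \sum_i x_i = - d_j] and
   [t_i = x_i . X], the vectors [u_i] are dual to the [x_i] up to scaling and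
   the fact reads [\sum_i 2 t_i / |u_i|^2 >= 1]. Projecting the [x_i] to the
   plane orthogonal to [X], it becomes an instance of
   [tr (M G) ^ 2 >= 4 det M det G] for 2x2 symmetric matrices, combined with
   [\sum_i |x_i|^2 / t_i = 2 (1 - mu_j) <= 2].

   Hence, if [r <= r'], on the inner side of each face the cap of the sphere of
   radius [r'] is contained in that of the sphere of radius [r]. So [O'] lies in
   the four balls of radius [r], whence [O' = O], and then all spheres agree. *)
Require Import Defs.
From HB Require Import structures.
From mathcomp Require Import all_boot all_order all_algebra.
From mathcomp Require Import all_classical all_reals all_analysis.
From mathcomp Require Import ring lra.

Set Implicit Arguments.
Unset Strict Implicit.
Unset Printing Implicit Defensive.

Import Order.TTheory GRing.Theory Num.Theory.
Import numFieldNormedType.Exports.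

Local Open Scope classical_set_scope.
Local Open Scope ring_scope.

(** * Inequalities for 2x2 symmetric matrices *)

(** Factor [M = L L^T] (Cholesky): the claim becomes [(p' + s')^2 >= 4 (p' s' - q'^2)] for the
    entries of [L^T G L]. Below, [A] and [B] are [a] times its diagonal entries. *)
Lemma trace_mul_sqr_ge (R : realFieldType) (a b c p q s : R) :
  0 < a -> 0 <= a * c - b ^+ 2 ->
  4 * (a * c - b ^+ 2) * (p * s - q ^+ 2) <= (a * p + 2 * b * q + c * s) ^+ 2.
Proof.
move=> a0 M0.
have a2 : 0 < a ^+ 2 by rewrite exprn_gt0.
rewrite -subr_ge0 -(pmulr_rge0 _ a2).
set A := a ^+ 2 * p + 2 * a * b * q + b ^+ 2 * s.
set B := (a * c - b ^+ 2) * s.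
suff -> : a ^+ 2 * ((a * p + 2 * b * q + c * s) ^+ 2
    - 4 * (a * c - b ^+ 2) * (p * s - q ^+ 2))
  = (A - B) ^+ 2 + 4 * (a * c - b ^+ 2) * (a * q + b * s) ^+ 2.
  by rewrite addr_ge0 ?sqr_ge0// mulr_ge0 ?sqr_ge0// mulr_ge0.
by rewrite /A /B; ring.
Qed.

(** The [n]'s play the role of inner products of plane vectors [y1], [y2], with [y3 = - (y1 + y2)].
    The right side [k] is [tr (M G)] for an [M] with [det M = t1 t2 t3 (t1 + t2 + t3)], and the last
    hypothesis says [k <= t1 t2 t3]. *)
Lemma inertia_ge_area (R : realFieldType) (t1 t2 t3 n11 n12 n22 : R) :
  0 < t1 -> 0 < t2 -> 0 < t3 -> 0 <= n11 * n22 - n12 ^+ 2 ->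
  0 <= n11 -> 0 <= n22 -> 0 <= n11 + 2 * n12 + n22 ->
  n11 / t1 + n22 / t2 + (n11 + 2 * n12 + n22) / t3 <= 1 ->
  (t1 + t2 + t3) * (n11 * n22 - n12 ^+ 2) <=
  n11 * (t2 * t3) + n22 * (t1 * t3) + (n11 + 2 * n12 + n22) * (t1 * t2).
Proof.
move=> t1p t2p t3p; set G := _ - _ => G0 n11p n22p n33p K1.
set k := (X in _ <= X).
have T0 : 0 < t1 * t2 * t3 by rewrite !mulr_gt0.
have kT : k <= t1 * t2 * t3.
  have -> : k = t1 * t2 * t3 *
      (n11 / t1 + n22 / t2 + (n11 + 2 * n12 + n22) / t3).
    by rewrite /k; field; rewrite !gt_eqF.
  by rewrite ger_pMr.
have k0 : 0 <= k by rewrite /k !addr_ge0// mulr_ge0// mulr_ge0 ?ltW.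
have q0 : 0 < t1 + t2 + t3 by rewrite !addr_gt0.
have qG : 0 <= (t1 + t2 + t3) * G by rewrite mulr_ge0// ltW.
have detM : (t2 * (t1 + t3)) * (t1 * (t2 + t3)) - (t1 * t2) ^+ 2 =
    t1 * t2 * t3 * (t1 + t2 + t3) by ring.
have kk : 4 * (t1 * t2 * t3 * (t1 + t2 + t3)) * G <= k ^+ 2.
  rewrite -detM /G.
  have -> : k = t2 * (t1 + t3) * n11 + 2 * (t1 * t2) * n12 + t1 * (t2 + t3) * n22.
    by rewrite /k; ring.
  apply: trace_mul_sqr_ge; first by rewrite mulr_gt0// addr_gt0.
  by rewrite detM mulr_ge0// ltW.
rewrite leNgt; apply/negP => klt.
have : k ^+ 2 <= t1 * t2 * t3 * k by rewrite expr2 ler_wpM2r.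
have : t1 * t2 * t3 * k < t1 * t2 * t3 * ((t1 + t2 + t3) * G).
  by rewrite ltr_pM2l.
have : 0 <= t1 * t2 * t3 * ((t1 + t2 + t3) * G) by rewrite mulr_ge0// ltW.
lra.
Qed.

(** * Inner product and triple product in coordinates *)

Definition dot (R : realType) (x y : 'rV[R]_3) : R := \sum_(k < 3) x 0 k * y 0 k.

Section Dot.
Variable R : realType.
Implicit Types x y z : 'rV[R]_3.

Lemma dotE x y : dot x y =
  x 0 0 * y 0 0 + x 0 1 * y 0 1 + x 0 (1 + 1) * y 0 (1 + 1).
Proof.
rewrite /dot !big_ord_recl big_ord0 addr0 addrA.
by congr (_ + x 0 _ * y 0 _ + x 0 _ * y 0 _); apply/val_inj.
Qed.

Lemma dotC x y : dot x y = dot y x.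
Proof. by rewrite !dotE; ring. Qed.

Lemma dotDl x y z : dot (x + y) z = dot x z + dot y z.
Proof. by rewrite !dotE !mxE; ring. Qed.

Lemma dotZl a x y : dot (a *: x) y = a * dot x y.
Proof. by rewrite !dotE !mxE; ring. Qed.

Lemma dotDr x y z : dot x (y + z) = dot x y + dot x z.
Proof. by rewrite !(dotC x) dotDl. Qed.

Lemma dotZr a x y : dot x (a *: y) = a * dot x y.
Proof. by rewrite !(dotC x) dotZl. Qed.

Lemma dotBl x y z : dot (x - y) z = dot x z - dot y z.
Proof. by rewrite !dotE !mxE; ring. Qed.

Lemma dotBr x y z : dot x (y - z) = dot x y - dot x z.
Proof. by rewrite !(dotC x) dotBl. Qed.

Lemma dotNr x y : dot x (- y) = - dot x y.
Proof. by rewrite -scaleN1r dotZr mulN1r. Qed.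

Lemma dot0l x : dot 0 x = 0.
Proof. by rewrite -(scale0r 0) dotZl mul0r. Qed.

Lemma dot_suml (I : finType) (F : I -> 'rV[R]_3) y :
  dot (\sum_i F i) y = \sum_i dot (F i) y.
Proof.
by apply: (big_morph (fun z => dot z y)) => [a b|]; rewrite ?dotDl ?dot0l.
Qed.

Lemma dot_sumr (I : finType) (F : I -> 'rV[R]_3) y :
  dot y (\sum_i F i) = \sum_i dot y (F i).
Proof. by rewrite dotC dot_suml; apply: eq_bigr => i _; rewrite dotC. Qed.

Lemma dot_ge0 x : 0 <= dot x x.
Proof. by apply: sumr_ge0 => k _; rewrite -expr2 sqr_ge0. Qed.

Lemma dot_eq0 x : (dot x x == 0) = (x == 0).
Proof.
apply/eqP/eqP => [|->]; last by rewrite dot0l.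
move=> /psumr_eq0P x0; apply/rowP => k; rewrite mxE; apply/eqP.
rewrite -[_ == _]orbb -mulf_eq0; apply/eqP/x0 => // l _.
by rewrite -expr2 sqr_ge0.
Qed.

Lemma dot_gt0 x : (0 < dot x x) = (x != 0).
Proof. by rewrite lt_def dot_ge0 andbT dot_eq0. Qed.

Lemma edist_sqr x c (r : R) : Defs.edist x c = r -> dot (x - c) (x - c) = r ^+ 2.
Proof.
move=> <-; rewrite sqr_sqrtr; first by apply: eq_bigr => k _; rewrite !mxE expr2.
by apply: sumr_ge0 => k _; rewrite sqr_ge0.
Qed.

Definition det3 x y z : R :=
    x 0 0 * (y 0 1 * z 0 (1 + 1) - y 0 (1 + 1) * z 0 1)
  - x 0 1 * (y 0 0 * z 0 (1 + 1) - y 0 (1 + 1) * z 0 0)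
  + x 0 (1 + 1) * (y 0 0 * z 0 1 - y 0 1 * z 0 0).

(** The right side is the Gram determinant, expanded along its first row. *)
Lemma det3_sqr x y z : det3 x y z ^+ 2 =
  dot x x * (dot y y * dot z z - dot y z ^+ 2)
  - dot x y * (dot x y * dot z z - dot y z * dot x z)
  + dot x z * (dot x y * dot y z - dot y y * dot x z).
Proof. by rewrite /det3 !dotE; ring. Qed.

Lemma det3_cycle x y z : det3 x y z = det3 y z x.
Proof. by rewrite /det3; ring. Qed.

(** The product of determinants is the determinant of the matrix of the [dot u_i x_j], here
    diagonal. *)
Lemma det3_mul_diag u1 u2 u3 x1 x2 x3 :
  dot u1 x2 = 0 -> dot u1 x3 = 0 -> dot u2 x1 = 0 -> dot u2 x3 = 0 ->
  dot u3 x1 = 0 -> dot u3 x2 = 0 ->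
  det3 u1 u2 u3 * det3 x1 x2 x3 = dot u1 x1 * dot u2 x2 * dot u3 x3.
Proof.
move=> e12 e13 e21 e23 e31 e32.
transitivity
  (dot u1 x1 * (dot u2 x2 * dot u3 x3 - dot u2 x3 * dot u3 x2)
   - dot u1 x2 * (dot u2 x1 * dot u3 x3 - dot u2 x3 * dot u3 x1)
   + dot u1 x3 * (dot u2 x1 * dot u3 x2 - dot u2 x2 * dot u3 x1)).
  by rewrite /det3 !dotE; ring.
by rewrite e12 e13 e21 e23 e31 e32; ring.
Qed.

(** Take squared norms in [det3 x y z * u = (u.x) y x z + (u.y) z x x + (u.z) x x y], written with
    cross products, where the last two terms vanish. *)
Lemma det3_sqr_normal u x y z : dot u y = 0 -> dot u z = 0 ->
  det3 x y z ^+ 2 * dot u u =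
  dot u x ^+ 2 * (dot y y * dot z z - dot y z ^+ 2).
Proof.
move=> uy uz.
have E : forall a b c : R,
   a = det3 x y z * u 0 0 -> b = det3 x y z * u 0 1 ->
   c = det3 x y z * u 0 (1 + 1) ->
   det3 x y z ^+ 2 * dot u u = a ^+ 2 + b ^+ 2 + c ^+ 2.
  by move=> _ _ _ -> -> ->; rewrite dotE; ring.
rewrite (E (dot u x * (y 0 1 * z 0 (1 + 1) - y 0 (1 + 1) * z 0 1))
           (dot u x * (y 0 (1 + 1) * z 0 0 - y 0 0 * z 0 (1 + 1)))
           (dot u x * (y 0 0 * z 0 1 - y 0 1 * z 0 0))).
- by rewrite !(dotE y) !(dotE z); ring.
- transitivity (dot u x * (y 0 1 * z 0 (1 + 1) - y 0 (1 + 1) * z 0 1)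
    + dot u y * (z 0 1 * x 0 (1 + 1) - z 0 (1 + 1) * x 0 1)
    + dot u z * (x 0 1 * y 0 (1 + 1) - x 0 (1 + 1) * y 0 1)).
    by rewrite uy uz; ring.
  by rewrite /det3 !dotE; ring.
- transitivity (dot u x * (y 0 (1 + 1) * z 0 0 - y 0 0 * z 0 (1 + 1))
    + dot u y * (z 0 (1 + 1) * x 0 0 - z 0 0 * x 0 (1 + 1))
    + dot u z * (x 0 (1 + 1) * y 0 0 - x 0 0 * y 0 (1 + 1))).
    by rewrite uy uz; ring.
  by rewrite /det3 !dotE; ring.
- transitivity (dot u x * (y 0 0 * z 0 1 - y 0 1 * z 0 0)
    + dot u y * (z 0 0 * x 0 1 - z 0 1 * x 0 0)
    + dot u z * (x 0 0 * y 0 1 - x 0 1 * y 0 0)).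
    by rewrite uy uz; ring.
  by rewrite /det3 !dotE; ring.
Qed.

End Dot.

(** * The key inequality for three vectors and their dual basis *)

(** Splitting each [x_i] into its component along [X] and its projection to the orthogonal plane
    reduces this to [inertia_ge_area]. *)
Lemma det3_sqr_le (R : realType) (x1 x2 x3 X : 'rV[R]_3) :
  X = x1 + x2 + x3 ->
  0 < dot x1 X -> 0 < dot x2 X -> 0 < dot x3 X ->
  dot x1 x1 / dot x1 X + dot x2 x2 / dot x2 X + dot x3 x3 / dot x3 X <= 2 ->
  2 * det3 x1 x2 x3 ^+ 2 <=
    dot x1 X * (dot x2 x2 * dot x3 x3 - dot x2 x3 ^+ 2)
  + dot x2 X * (dot x3 x3 * dot x1 x1 - dot x3 x1 ^+ 2)
  + dot x3 X * (dot x1 x1 * dot x2 x2 - dot x1 x2 ^+ 2).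
Proof.
move=> XE; set t1 := dot x1 X; set t2 := dot x2 X; set t3 := dot x3 X.
move=> t1p t2p t3p K2.
set q := t1 + t2 + t3.
have q0 : 0 < q by rewrite !addr_gt0.
have qE : q = dot X X by rewrite {1}XE !dotDl.
(* [y] is the projection orthogonal to [X], kept opaque so that it is unfolded only through [yE]. *)
have [y yE] : {y : 'rV[R]_3 -> 'rV[R]_3 | forall x, y x = x - (dot x X / q) *: X}.
  by exists (fun x => x - (dot x X / q) *: X).
have dy x x' : dot (y x) (y x') = dot x x' - dot x X * dot x' X / q.
  rewrite !yE !dotBl !dotBr !dotZl !dotZr -qE (dotC X x').
  by field; rewrite gt_eqF.
have y3 : y x3 = - (y x1 + y x2).
  have -> : x3 = X - x1 - x2 by rewrite XE; apply/rowP => k; rewrite !mxE; ring.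
  rewrite !yE !dotBl -qE; apply/rowP => k; rewrite !mxE -/t1 -/t2.
  by field; rewrite gt_eqF.
have g x x' : dot x x' = dot (y x) (y x') + dot x X * dot x' X / q.
  by rewrite dy subrK.
set n11 := dot (y x1) (y x1).
set n12 := dot (y x1) (y x2).
set n22 := dot (y x2) (y x2).
have n33 : dot (y x3) (y x3) = n11 + 2 * n12 + n22.
  rewrite y3 -scaleN1r dotZl dotZr !dotDl !dotDr (dotC (y x2) (y x1)).
  by rewrite -/n11 -/n12 -/n22; ring.
have n13 : dot (y x1) (y x3) = - (n11 + n12).
  by rewrite y3 -scaleN1r dotZr dotDr; rewrite -/n11 -/n12; ring.
have n23 : dot (y x2) (y x3) = - (n12 + n22).
  by rewrite y3 -scaleN1r dotZr dotDr (dotC (y x2) (y x1)) -/n12 -/n22; ring.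
have g11 : dot x1 x1 = n11 + t1 * t1 / q by rewrite g.
have g12 : dot x1 x2 = n12 + t1 * t2 / q by rewrite g.
have g22 : dot x2 x2 = n22 + t2 * t2 / q by rewrite g.
have g13 : dot x1 x3 = - (n11 + n12) + t1 * t3 / q by rewrite g n13.
have g23 : dot x2 x3 = - (n12 + n22) + t2 * t3 / q by rewrite g n23.
have g33 : dot x3 x3 = n11 + 2 * n12 + n22 + t3 * t3 / q by rewrite g n33.
have D2 : det3 x1 x2 x3 ^+ 2 = q * (n11 * n22 - n12 ^+ 2).
  rewrite det3_sqr g11 g12 g13 g22 g23 g33 /q; field.
  by rewrite gt_eqF.
have := @inertia_ge_area R t1 t2 t3 n11 n12 n22 t1p t2p t3p.
(* The components along [X] contribute [t1 / q + t2 / q + t3 / q = 1]. *)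
have -> : n11 / t1 + n22 / t2 + (n11 + 2 * n12 + n22) / t3 =
   (dot x1 x1 / t1 + dot x2 x2 / t2 + dot x3 x3 / t3) - 1.
  rewrite g11 g22 g33 /q; field.
  by rewrite !gt_eqF.
rewrite -/q.
have -> : 0 <= n11 * n22 - n12 ^+ 2.
  by rewrite -(pmulr_rge0 _ q0) -D2 sqr_ge0.
rewrite !dot_ge0 -n33 dot_ge0.
have -> : dot x1 x1 / t1 + dot x2 x2 / t2 + dot x3 x3 / t3 - 1 <= 1 by lra.
move=> /(_ isT isT isT isT isT).
(* The right side of the goal is [q * (n11 * n22 - n12 ^+ 2)], that is [det3 x1 x2 x3 ^+ 2], plus
   the right side of [inertia_ge_area]. *)
rewrite n33 D2 -subr_ge0 => h; rewrite -subr_ge0; apply: (le_trans h).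
rewrite le_eqVlt; apply/orP; left; apply/eqP.
rewrite (dotC x3 x1) g11 g12 g13 g22 g23 g33 /q; field.
by rewrite gt_eqF.
Qed.

(* [u] is, up to scaling, the dual basis of [x], so that
   [4 * det3 x ^+ 2 = |u_i| ^+ 2 * |x_j x x_k| ^+ 2]. *)
Lemma sum_ratio_ge1 (R : realType) (x u : 'I_3 -> 'rV[R]_3) :
  let X := \sum_i x i in
  (forall i, u i != 0) ->
  (forall i j, dot (u i) (x j) = if i == j then - dot (u i) (u i) / 2 else 0) ->
  (forall i, 0 < dot (x i) X) ->
  \sum_i dot (x i) (x i) / dot (x i) X <= 2 ->
  1 <= \sum_i 2 * dot (x i) X / dot (u i) (u i).
Proof.
move=> X u0 ux t0.
have XE : X = x 0 + x 1 + x (1 + 1).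
  rewrite /X !big_ord_recl big_ord0 addr0 addrA.
  by congr (_ + x _ + x _); apply/val_inj.
have sumE (F : 'I_3 -> R) : \sum_i F i = F 0 + F 1 + F (1 + 1).
  rewrite !big_ord_recl big_ord0 addr0 addrA.
  by congr (_ + F _ + F _); apply/val_inj.
rewrite !sumE => /(det3_sqr_le XE (t0 _) (t0 _) (t0 _)).
set D := det3 _ _ _.
have V0 i : 0 < dot (u i) (u i) by rewrite dot_gt0.
have D0 : 0 < D ^+ 2.
  rewrite exprn_even_gt0//=.
  have := @det3_mul_diag R (u 0) (u 1) (u (1 + 1)) (x 0) (x 1) (x (1 + 1)).
  rewrite !ux/= => /(_ erefl erefl erefl erefl erefl erefl) E.
  apply/eqP => D0; move: E; rewrite -/D D0 mulr0 => /esym/eqP.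
  by rewrite !mulf_eq0 !oppr_eq0 !invr_eq0 !gt_eqF// pnatr_eq0.
have o i j : i != j -> dot (u i) (x j) = 0 by move=> /negPf ij; rewrite ux ij.
have gramE i y z : det3 (x i) y z = D -> dot (u i) y = 0 -> dot (u i) z = 0 ->
    dot y y * dot z z - dot y z ^+ 2 = 4 * D ^+ 2 / dot (u i) (u i).
  move=> E uy uz; have := det3_sqr_normal (x i) uy uz.
  rewrite E ux eqxx => h; have Vi := V0 i.
  apply: (@mulfI _ (dot (u i) (u i) ^+ 2)); first by rewrite expf_neq0 ?gt_eqF.
  transitivity (4 * ((- dot (u i) (u i) / 2) ^+ 2 *
      (dot y y * dot z z - dot y z ^+ 2))); first by field.
  by rewrite -h; field; rewrite gt_eqF.
rewrite (gramE 0 (x 1) (x (1 + 1)) erefl (o 0 1 isT) (o 0 (1 + 1) isT)).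
rewrite (gramE 1 (x (1 + 1)) (x 0) _ (o 1 (1 + 1) isT) (o 1 0 isT)); last first.
  by rewrite -det3_cycle.
rewrite (gramE (1 + 1) (x 0) (x 1) _ (o (1 + 1) 0 isT) (o (1 + 1) 1 isT)); last first.
  by rewrite det3_cycle.
(* Every term of [h] now carries the factor [2 * D ^+ 2], which cancels. *)
move=> h; rewrite -(ler_pM2l (mulr_gt0 (ltr0n _ 2) D0)) mulr1.
apply: (le_trans h); rewrite le_eqVlt; apply/orP; left; apply/eqP.
by field; rewrite !gt_eqF.
Qed.

(** * Barycentric coordinates and interior points *)

(** Affine independence makes the matrix with rows [(v_i, 1)] invertible; column [j] of the inverse
    is the pair [(n j, k j)]. *)
Lemma barycentric_coordinates (R : realType) (v : 'I_4 -> 'rV[R]_3) :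
  affinely_independent v ->
  exists (n : 'I_4 -> 'rV[R]_3) (k : 'I_4 -> R),
    [/\ forall i j, dot (n j) (v i) + k j = (i == j)%:R,
        forall x, \sum_j (dot (n j) x + k j) = 1 &
        forall x, x = \sum_j (dot (n j) x + k j) *: v j].
Proof.
move=> vfree.
pose M : 'M[R]_(4, 3 + 1) := \matrix_i row_mx (v i) 1%:M.
have comb (a : 'rV[R]_4) :
    a *m M = row_mx (\sum_i a 0 i *: v i) (\sum_i a 0 i)%:M.
  rewrite mulmx_sum_row -[LHS]hsubmxK; congr row_mx.
    rewrite linear_sum; apply: eq_bigr => i _.
    by rewrite linearZ /= rowK row_mxKl.
  rewrite linear_sum [RHS]raddf_sum; apply: eq_bigr => i _.
  by rewrite linearZ /= rowK row_mxKr scale_scalar_mx mulr1.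
have Mu : (M : 'M[R]_4) \in unitmx.
  rewrite -row_free_unit; apply: inj_row_free => a aM.
  have : a *m M = row_mx 0 0 by rewrite row_mx0.
  rewrite comb => /eq_row_mx[av a1].
  have a10 : \sum_i a 0 i = 0 by move/matrixP: a1 => /(_ 0 0); rewrite !mxE.
  by apply/rowP => i; rewrite mxE; apply: (vfree (fun i => a 0 i)).
pose N : 'M[R]_(3 + 1, 4) := invmx (M : 'M[R]_4).
exists (fun j => (col j (usubmx N))^T), (fun j => dsubmx N 0 j).
have betaE x j : dot (col j (usubmx N))^T x + dsubmx N 0 j =
    (row_mx x 1%:M *m N) 0 j.
  rewrite -[in RHS](vsubmxK N) mul_row_col mul1mx [RHS]mxE; congr (_ + _).
  by rewrite /dot [RHS]mxE; apply: eq_bigr => l _; rewrite !mxE mulrC.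
have NK x : (row_mx x 1%:M *m N) *m M = row_mx x 1%:M.
  by rewrite -mulmxA mulVmx// mulmx1.
split=> [i j|x|x].
- rewrite betaE.
  have -> : row_mx (v i) 1%:M = row i M by rewrite rowK.
  by rewrite -row_mul mulmxV// !mxE.
- have := NK x; rewrite comb => /eq_row_mx[_] /matrixP/(_ 0 0).
  rewrite !mxE eqxx !mulr1n => <-.
  by apply: eq_bigr => j _; rewrite betaE.
- have := NK x; rewrite comb => /eq_row_mx[+ _] => {1}<-.
  by apply: eq_bigr => j _; rewrite betaE.
Qed.

(** A short move from [O] along [- n] stays in the tetrahedron, where the affine function is
    nonnegative, but strictly decreases it. *)
Lemma interior_tetrahedron_gt0 (R : realType) (v : 'I_4 -> 'rV[R]_3)
    (O n : 'rV[R]_3) (k : R) :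
  (forall i, 0 <= dot n (v i) + k) -> n != 0 ->
  interior (tetrahedron v) O -> 0 < dot n O + k.
Proof.
move=> vk n0 OT.
have sub : tetrahedron v `<=` [set x | 0 <= dot n x + k].
  apply: smallest_sub => [x y l|_ [i _ <-]]; last exact: vk.
  rewrite !inE /= => xk yk.
  have -> : conv l (x : convex_lmodType _) y = l%:num *: x + (1 - l%:num) *: y by [].
  rewrite dotDr !dotZr.
  have l0 : 0 <= l%:num by [].
  have l1 : 0 <= 1 - l%:num by rewrite subr_ge0.
  have := mulr_ge0 l0 xk; have := mulr_ge0 l1 yk; lra.
have cvgO : O - t *: n @[t --> (0 : R)] --> O - 0 *: n.
  apply: cvgB; first exact: cvg_cst.
  by apply: cvgZr_tmp; exact: cvg_id.
rewrite scale0r subr0 in cvgO.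
have /nbhs_ballP[e /= e0 he] := cvgO _ OT.
have /he/sub /= : ball (0 : R) e (e / 2).
  by rewrite /ball /= sub0r normrN gtr0_norm ?divr_gt0// ltr_pdivrMr// ltr_pMr// ltr1n.
rewrite dotBr dotZr.
have : 0 < e / 2 * dot n n by rewrite mulr_gt0 ?divr_gt0 ?dot_gt0.
lra.
Qed.

(** * Position of the centers relative to the faces *)

Section Centers.
Variables (R : realType) (u d : 'I_4 -> 'rV[R]_3) (lam : 'I_4 -> R) (q : R).
Hypothesis lam_gt0 : forall i, 0 < lam i.
Hypothesis lam_u : \sum_i lam i *: u i = 0.
Hypothesis u_span : forall z, (forall i, dot z (u i) = 0) -> z = 0.
Hypothesis u_neq0 : forall i, u i != 0.
Hypothesis d_norm : forall j, dot (d j) (d j) = q.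
Hypothesis u_on_sphere :
  forall i j, i != j -> dot (u i) (u i) = 2 * dot (u i) (d j).

(** Pairing [lam_u] with [d i] gives the last identity; with it, [\sum_i mu i *: d i] is orthogonal
    to every [u i], hence zero. *)
Lemma center_weights : exists mu : 'I_4 -> R,
  [/\ forall i, 0 < mu i, \sum_i mu i = 1, \sum_i mu i *: d i = 0 &
      forall i, mu i * dot (u i) (d i) = (mu i - 1) * dot (u i) (u i) / 2].
Proof.
pose L := \sum_i lam i * dot (u i) (u i).
have W0 i : 0 < lam i * dot (u i) (u i) by rewrite mulr_gt0 ?dot_gt0.
have L0 : 0 < L.
  by rewrite /L (bigD1_ord ord0)//= ltr_pwDl// sumr_ge0// => i _; exact: ltW.
pose mu i := lam i * dot (u i) (u i) / L.
have mu1 : \sum_i mu i = 1 by rewrite -mulr_suml divff ?gt_eqF.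
have mu_ud i : mu i * dot (u i) (d i) = (mu i - 1) * dot (u i) (u i) / 2.
  have E : lam i * dot (u i) (d i) = - (L - lam i * dot (u i) (u i)) / 2.
    have := congr1 (fun z => dot z (d i)) lam_u; rewrite dot_suml dot0l.
    rewrite (bigD1_ord i)//= dotZl => /eqP; rewrite addr_eq0 => /eqP ->.
    rewrite /L (bigD1_ord i)//= addrAC subrr add0r mulNr mulr_suml.
    congr (- _); apply: eq_bigr => k _.
    rewrite dotZl (@u_on_sphere _ i); first by field.
    by rewrite eq_sym neq_lift.
  transitivity (dot (u i) (u i) / L * (lam i * dot (u i) (d i))).
    by rewrite /mu; field; rewrite gt_eqF.
  by rewrite E /mu; field; rewrite gt_eqF.
exists mu; split => // [i|]; first by rewrite divr_gt0.
apply: u_span => i; rewrite dot_suml (bigD1_ord i)//= dotZl (dotC (d i)) mu_ud.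
rewrite (eq_bigr (fun k => mu (lift i k) * (dot (u i) (u i) / 2))); last first.
  move=> k _; rewrite dotZl (@u_on_sphere i (lift i k)); last by rewrite neq_lift.
  by rewrite (dotC (d _)); field.
rewrite -mulr_suml; move: mu1; rewrite (bigD1_ord i)//= => /eqP.
by rewrite eq_sym addrC -subr_eq => /eqP <-; ring.
Qed.

(** With [O] as origin, [m] is the normal of the face opposite to [v_j], scaled so that its plane is
    [m . x = 1]. *)
Lemma center_beyond_face (j : 'I_4) (m : 'rV[R]_3) :
  (forall i, i != j -> dot m (u i) = 1) -> 1 <= dot m (d j).
Proof.
move=> mu_1; have [mu [mu0 mu1 mud muud]] := center_weights.
pose x k := mu (lift j k) *: (d (lift j k) - d j).
pose u' k := u (lift j k).
have XE : \sum_k x k = - d j.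
  rewrite /x; under eq_bigr do rewrite scalerBr.
  rewrite big_split /= sumrN -scaler_suml.
  move: mu1 mud; rewrite (bigD1_ord j)//= => /eqP.
  rewrite addrC eq_sym -subr_eq => /eqP <-.
  rewrite (bigD1_ord j)//= => /eqP; rewrite addrC addr_eq0 => /eqP ->.
  by rewrite scalerBl scale1r opprB addrA addNr add0r.
have u'0 k : u' k != 0 by exact: u_neq0.
have u'x k l : dot (u' k) (x l) = if k == l then - dot (u' k) (u' k) / 2 else 0.
  have uj : dot (u' k) (d j) = dot (u' k) (u' k) / 2.
    rewrite /u' (@u_on_sphere (lift j k) j); first by field.
    by rewrite eq_sym neq_lift.
  rewrite /x dotZr dotBr uj; case: eqVneq => [<-|kl].
    by rewrite mulrBr muud -/(u' k); field.
  rewrite /u' (@u_on_sphere (lift j k) (lift j l)); last by rewrite (inj_eq (@lift_inj _ j)).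
  by field.
(* Since all [d i] have the same length, [|d_k - d_j|^2 = 2 (d_k - d_j) . (- d_j)]. *)
have xx k : dot (x k) (x k) = 2 * mu (lift j k) * dot (x k) (- d j).
  rewrite /x dotNr !dotZl !dotZr !dotBl !dotBr !d_norm (dotC (d j)).
  by ring.
have x0 k : x k != 0.
  apply/eqP => xk; have := u'x k k.
  rewrite xk dotC dot0l eqxx => /esym/eqP.
  by rewrite mulf_eq0 oppr_eq0 dot_eq0 (negPf (u'0 k)) invr_eq0 pnatr_eq0.
have t0 k : 0 < dot (x k) (- d j).
  have : 0 < dot (x k) (x k) by rewrite dot_gt0.
  by rewrite xx pmulr_rgt0// mulr_gt0.
have := sum_ratio_ge1 (x := x) (u := u') u'0 u'x.
rewrite XE => /(_ t0).
rewrite (eq_bigr (fun k => 2 * mu (lift j k))); last first.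
  by move=> k _; rewrite xx mulfK// gt_eqF.
rewrite -mulr_sumr; move: (mu1); rewrite (bigD1_ord j)//= => /eqP.
rewrite addrC eq_sym -subr_eq => /eqP <-.
have -> : 2 * (1 - mu j) <= 2 by have := mu0 j; lra.
move=> /(_ isT) h; apply: (le_trans h).
(* Duality gives the coefficients of [m] in the [x k]. The identity is tested on the [u i]; the case
   [i = j] follows from [lam_u]. *)
have mE : m = \sum_k (- 2 / dot (u' k) (u' k)) *: x k.
  apply/eqP; rewrite -subr_eq0; apply/eqP; apply: u_span.
  set z := m - _.
  have zl k : dot z (u' k) = 0.
    rewrite /z dotBl mu_1; last by rewrite eq_sym neq_lift.
    rewrite dot_suml (bigD1 k)//= dotZl dotC u'x eqxx big1 => [|l lk].
      by field; rewrite dot_eq0.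
    by rewrite dotZl dotC u'x eq_sym (negPf lk) mulr0.
  move=> i; have [k ->|->] := unliftP j i; first exact: zl.
  have := congr1 (dot z) lam_u; rewrite dot_sumr (dotC z 0) dot0l.
  rewrite (bigD1_ord j)//= big1 => [|k _]; last by rewrite dotZr zl mulr0.
  by rewrite addr0 dotZr => /eqP; rewrite mulf_eq0 gt_eqF//= => /eqP.
rewrite mE dot_suml le_eqVlt; apply/orP; left; apply/eqP.
apply: eq_bigr => k _; rewrite dotNr [RHS]dotZl.
by field; rewrite dot_eq0.
Qed.

End Centers.

(** * Comparison of two four-crossing points *)

Lemma four_crossing_centers (R : realType) (v : 'I_4 -> 'rV[R]_3) r O :
  four_crossing v r O -> exists c : 'I_4 -> 'rV[R]_3,
    (forall j, dot (O - c j) (O - c j) = r ^+ 2) /\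
    (forall i j, i != j -> dot (v i - c j) (v i - c j) = r ^+ 2).
Proof.
move=> [_ [S [_ Ssph Sv SO _]]]; have [c cP] := choice Ssph; exists c.
split=> [j|i j ij]; apply: edist_sqr.
  have SOO : (\bigcap_j S j) O by rewrite SO.
  by have := SOO j I; rewrite cP.
by have := Sv j i ij; rewrite cP.
Qed.

Section Barycentric.
Variables (R : realType) (v n : 'I_4 -> 'rV[R]_3) (k : 'I_4 -> R).
Let beta j x := dot (n j) x + k j.
Hypothesis beta_v : forall i j, beta j (v i) = (i == j)%:R.
Hypothesis beta_sum1 : forall x, \sum_j beta j x = 1.
Hypothesis betaK : forall x, x = \sum_j beta j x *: v j.

Lemma affine_barycentric (a x : 'rV[R]_3) (b : R) :
  dot a x + b = \sum_j beta j x * (dot a (v j) + b).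
Proof.
rewrite {1}(betaK x) dot_sumr -[b in LHS]mul1r -(beta_sum1 x) mulr_suml -big_split.
by apply: eq_bigr => j _ /=; rewrite dotZr mulrDr.
Qed.

Lemma beta_diff j x y : beta j x - beta j y = dot (n j) (x - y).
Proof. by rewrite /beta dotBr; ring. Qed.

Lemma crossing_centers_beyond_faces r (O : 'rV[R]_3) (c : 'I_4 -> 'rV[R]_3) :
  (forall j, 0 < beta j O) ->
  (forall j, dot (O - c j) (O - c j) = r ^+ 2) ->
  (forall i j, i != j -> dot (v i - c j) (v i - c j) = r ^+ 2) ->
  (exists mu : 'I_4 -> R, [/\ forall i, 0 < mu i, \sum_i mu i = 1 &
     \sum_i mu i *: (c i - O) = 0]) /\
  (forall j, beta j (c j) <= 0).
Proof.
move=> bO cO cv.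
have uO : \sum_i beta i O *: (v i - O) = 0.
  under eq_bigr do rewrite scalerBr.
  by rewrite sumrB -scaler_suml beta_sum1 scale1r -betaK subrr.
have span z : (forall i, dot z (v i - O) = 0) -> z = 0.
  move=> h; apply/eqP; rewrite -dot_eq0; apply/eqP.
  (* The affine function [dot z (x - O)] vanishes at all vertices, hence also at [z + O], where it
     equals [dot z z]. *)
  have := affine_barycentric z (z + O) (- dot z O).
  rewrite dotDr addrK => ->; apply: big1 => j _.
  by rewrite -dotBr h mulr0.
have u0 i : v i - O != 0.
  apply/eqP => /eqP; rewrite subr_eq0 => /eqP vi.
  have := bO (lift i ord0); rewrite -vi beta_v.
  by rewrite (negPf (neq_lift _ _)) ltxx.
have dn j : dot (c j - O) (c j - O) = r ^+ 2.
  by rewrite -opprB dotNr dotC dotNr opprK.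
have us i j : i != j ->
    dot (v i - O) (v i - O) = 2 * dot (v i - O) (c j - O).
  move=> ij; have := cv i j ij.
  have -> : v i - c j = (v i - O) - (c j - O) by rewrite opprB addrA subrK.
  move: (v i - O) (c j - O) (dn j) => p s ss.
  rewrite dotBl !dotBr ss (dotC s p); lra.
split.
  by have [mu [? ? ? _]] := center_weights bO uO span u0 us; exists mu.
move=> j.
have b0 := bO j.
(* From [O] to a vertex of face [j], [beta j] drops from [beta j O] to 0; this fixes the scaling of
   the normal. *)
have := @center_beyond_face R _ _ _ _ bO uO span u0 dn us j (- (beta j O)^-1 *: n j).
rewrite dotZl -beta_diff => h.
have : 1 <= - (beta j O)^-1 * (beta j (c j) - beta j O).
  apply: h => i ij; rewrite dotZl -beta_diff beta_v (negPf ij) sub0r.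
  by rewrite mulrN mulNr opprK mulVf// gt_eqF.
rewrite mulNr mulrBr mulVf ?gt_eqF// opprB lerBrDr gerDl.
by rewrite pmulr_rle0// invr_gt0.
Qed.

(* The difference of the two sphere equations is a multiple of [beta j]; since
   both centers lie beyond the face, the larger sphere cuts off the smaller
   cap on the side of the tetrahedron, so [O'] is in all balls around [c]. *)
Lemma crossing_unique_le r r' (O O' : 'rV[R]_3) (c c' : 'I_4 -> 'rV[R]_3) :
  0 < r -> r <= r' ->
  (forall j, 0 < beta j O) -> (forall j, 0 < beta j O') ->
  (forall j, dot (O - c j) (O - c j) = r ^+ 2) ->
  (forall i j, i != j -> dot (v i - c j) (v i - c j) = r ^+ 2) ->
  (forall j, dot (O' - c' j) (O' - c' j) = r' ^+ 2) ->
  (forall i j, i != j -> dot (v i - c' j) (v i - c' j) = r' ^+ 2) ->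
  r = r' /\ O = O'.
Proof.
move=> r0 rr bO bO' cO cv cO' cv'; have r'0 := lt_le_trans r0 rr.
have [[mu [mu0 mu1 muc]] bc] := crossing_centers_beyond_faces bO cO cv.
have [_ bc'] := crossing_centers_beyond_faces bO' cO' cv'.
pose f j x := dot (x - c j) (x - c j) - r ^+ 2.
pose f' j x := dot (x - c' j) (x - c' j) - r' ^+ 2.
pose h j := f' j (v j) - f j (v j).
(* The quadratic terms cancel, so the difference is affine; it vanishes at the vertices of face
   [j]. *)
have fE j x : f' j x - f j x = h j * beta j x.
  pose a := 2 *: (c j - c' j).
  pose b := dot (c' j) (c' j) - r' ^+ 2 - dot (c j) (c j) + r ^+ 2.
  have aff y : f' j y - f j y = dot a y + b.
    rewrite /f /f' /a /b dotZl !dotBl !dotBr (dotC (c j) y) (dotC (c' j) y).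
    by ring.
  rewrite aff affine_barycentric (bigD1 j)//= -aff -/(h j) big1 => [|i ij].
    by rewrite addr0 mulrC.
  by rewrite -aff /f /f' cv// cv'// !subrr mulr0.
(* Compare the gradients of both sides of [fE]. *)
have grad j : 2 *: (c j - c' j) = h j *: n j.
  apply/eqP; rewrite -subr_eq0 -dot_eq0; apply/eqP.
  set z := _ - _.
  have E x : f' j x - f j x - (f' j 0 - f j 0) = 2 * dot (c j - c' j) x.
    rewrite /f /f' !dotBl !dotBr (dotC (c j) x) (dotC (c' j) x).
    by rewrite !dot0l !(dotC _ 0) !dot0l; ring.
  have : f' j z - f j z - (f' j 0 - f j 0) = h j * dot (n j) z.
    by rewrite !fE -mulrBr beta_diff subr0.
  by rewrite E => e; rewrite {1}/z dotBl !dotZl e subrr.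
(* If [h j < 0], then [bd] puts [c j] strictly below [c' j] for [beta j], so both values being at
   most 0 their sum is negative; but [bsum] and [r <= r'] make it nonnegative. *)
have h0 j : 0 <= h j.
  rewrite leNgt; apply/negP => hj.
  have [i ij] : exists i, i != j.
    by exists (lift j ord0); rewrite eq_sym neq_lift.
  have bd : 2 * (beta j (c j) - beta j (c' j)) = h j * dot (n j) (n j).
    by rewrite beta_diff -dotZr grad dotZr.
  have n0 : 0 < dot (n j) (n j).
    rewrite dot_gt0; apply/eqP => nj.
    have := beta_diff j (v j) (v i).
    by rewrite nj dot0l !beta_v eqxx (negPf ij) subr0 => /eqP; rewrite oner_eq0.
  have r2 : r ^+ 2 <= r' ^+ 2 by rewrite ler_pXn2r// nnegrE ltW.
  have bsum : 2 * (r' ^+ 2 - r ^+ 2) =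
      - h j * (beta j (c j) + beta j (c' j)).
    rewrite -(cv i j ij) -(cv' i j ij).
    have biv : beta j (v i) = 0 by rewrite beta_v (negPf ij).
    transitivity (- dot (2 *: (c j - c' j)) (c j - v i + (c' j - v i))).
      rewrite dotZl !(dotBl, dotBr, dotDr) !(dotC _ (v i)) (dotC (c' j) (c j)).
      by ring.
    rewrite grad dotZl dotDr -!beta_diff biv; ring.
  have : h j * dot (n j) (n j) < 0 by rewrite nmulr_rlt0.
  rewrite -bd => lt.
  have hn : 0 < - h j by rewrite oppr_gt0.
  have : 0 <= - h j * (beta j (c j) + beta j (c' j)) by rewrite -bsum; lra.
  rewrite pmulr_rge0// => ge.
  have := bc j; have := bc' j; lra.
have OO : O' = O.
  apply/eqP; rewrite -subr_eq0 -dot_eq0 eq_le dot_ge0 andbT.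
  (* This says that [O'] lies in the ball around [c j]. Averaging over [j] with the weights [mu]
     kills the right side. *)
  have le j : dot (O' - O) (O' - O) <= 2 * dot (c j - O) (O' - O).
    have : f j O' <= 0.
      have := fE j O'; rewrite {1}/f' cO' subrr sub0r => /eqP.
      rewrite eqr_oppLR => /eqP ->.
      by rewrite oppr_le0 mulr_ge0// ltW.
    have -> : f j O' = dot (O' - O) (O' - O) - 2 * dot (c j - O) (O' - O).
      rewrite /f -(cO j).
      have -> : O' - c j = (O' - O) - (c j - O) by rewrite opprB addrA subrK.
      rewrite -(opprB (c j) O).
      move: (O' - O) (c j - O) => p s.
      by rewrite dotNr (dotC _ s) dotNr opprK !(dotBl, dotBr) (dotC p s); ring.
    by rewrite subr_le0.
  have : \sum_j mu j * dot (O' - O) (O' - O) <=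
         \sum_j mu j * (2 * dot (c j - O) (O' - O)).
    by apply: ler_sum => j _; rewrite ler_wpM2l// ltW.
  rewrite -mulr_suml mu1 mul1r => /le_trans; apply.
  have -> : \sum_j mu j * (2 * dot (c j - O) (O' - O)) =
      2 * dot (\sum_j mu j *: (c j - O)) (O' - O).
    rewrite dot_suml mulr_sumr; apply: eq_bigr => j _.
    by rewrite dotZl mulrCA.
  by rewrite muc dot0l mulr0.
split=> //.
(* Both [f] and [f'] vanish at the common point [O], where [beta] is positive. So [h] is zero, the
   centers agree, and then the radii. *)
have hz : h ord0 = 0.
  have := fE ord0 O; rewrite /f /f' cO -{1 2}OO cO' !subrr => /esym/eqP.
  by rewrite mulf_eq0 (gt_eqF (bO _)) orbF => /eqP.
have := grad ord0.
rewrite hz scale0r => /eqP; rewrite scaler_eq0 pnatr_eq0/= subr_eq0 => /eqP cc.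
have := cO ord0; rewrite cc -OO cO' => /eqP.
by rewrite eqrXn2 ?ltW// => /eqP ->.
Qed.

End Barycentric.

Theorem theorem4p12 (R : realType) (v : 'I_4 -> 'rV[R]_3)
    (r r' : R) (O O' : 'rV[R]_3) :
  affinely_independent v ->
  four_crossing v r O -> four_crossing v r' O' ->
  interior (tetrahedron v) O -> interior (tetrahedron v) O' ->
  r = r' /\ O = O'.
Proof.
move=> vfree crO crO' OT OT'.
have [n [k [bv b1 bK]]] := barycentric_coordinates vfree.
have bpos x j : interior (tetrahedron v) x -> 0 < dot (n j) x + k j.
  apply: interior_tetrahedron_gt0 => [i|]; first by rewrite bv ler0n.
  apply/eqP => nj; have := bv j j; rewrite eqxx nj dot0l add0r => kj.
  have := bv (lift j ord0) j; rewrite nj dot0l add0r kj eq_sym.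
  by rewrite (negPf (neq_lift _ _)) => /eqP; rewrite oner_eq0.
have [c [cO cv]] := four_crossing_centers crO.
have [c' [cO' cv']] := four_crossing_centers crO'.
have [r0 _] := crO; have [r0' _] := crO'.
have bO j := bpos O j OT; have bO' j := bpos O' j OT'.
have [rr|/ltW rr] := leP r r'.
  exact: (crossing_unique_le bv b1 bK r0 rr bO bO' cO cv cO' cv').
by have [-> ->] := crossing_unique_le bv b1 bK r0' rr bO' bO cO' cv' cO cv.
Qed.
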